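(* Let $s\ge 0$, let $n\ge 1$ be an integer, and let $s_1,\dots,s_n\ge 0$ be real numbers with $\sum_{i=1}^n s_i\le s$. Let $f:\mathbb{R}\to\mathbb{C}$ be a function of the form $$f(\xi)=\prod_{i=1}^n\bigl(1+\chi(s_i)\,(\pm 2\pi \xi i)^{s_i}\bigr),$$ where the sign $\pm$ may be chosen in each factor (inside the power, $i$ denotes the imaginary unit). Put $\tau=s-\sum_{i=1}^n s_i$. Then for $v\in L^2(\mathbb{R})$ the following holds: $v\in\widehat{H}^s(\mathbb{R})$ if and only if there exists $u\in\widehat{H}^\tau(\mathbb{R})$ such that $f(\xi)\,\widehat{v}(\xi)=\widehat{u}(\xi)$ for a.e. $\xi\in\mathbb{R}$.
   Context: All functions in $L^2(\mathbb{R})$ and $\widehat{H}^\mu(\mathbb{R})$ are real valued (their transforms may be complex valued), and equality of $L^2$ functions means equality a.e. Fourier transform: $\mathcal{F}(g)(\xi)=\int_{\mathbb{R}}e^{-2\pi i x\xi}g(x)\,dx$; for $g\in L^2(\mathbb{R})$, $\widehat{g}$ denotes its Plancherel transform, i.e. the isometric extension to $L^2$ that agrees with $\mathcal{F}(g)$ on $L^1\cap L^2$. For $\mu\ge 0$, $\widehat{H}^\mu(\mathbb{R})=\{w\in L^2(\mathbb{R}):\int_{\mathbb{R}}(1+|2\pi\xi|^{2\mu})|\widehat{w}(\xi)|^2\,d\xi<\infty\}$. Complex powers: for $\sigma\ge 0$ and $\xi\neq 0$, $(\pm 2\pi \xi i)^{\sigma}=|2\pi\xi|^{\sigma}e^{\pm\sigma\pi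 i\,\mathrm{sign}(\xi)/2}$. The function $\chi:[0,\infty)\to\{1,-1\}$ is defined by: $\chi(r)=1$ if $\frac r2\in[0,\frac12]$ or $\frac r2\in[\frac32+2k,\frac52+2k]$ for some $k\in\{0,1,2,\dots\}$; $\chi(r)=-1$ if $\frac r2\in(\frac12+2k,\frac32+2k)$ for some $k\in\{0,1,2,\dots\}$. *)

(* Defs.v *)
From HB Require Import structures.
From mathcomp Require Import all_boot all_order all_algebra.
From mathcomp Require Import all_classical all_reals all_analysis.
From mathcomp Require Import complex.

Set Implicit Arguments.
Unset Strict Implicit.
Unset Printing Implicit Defensive.
Import Order.TTheory GRing.Theory Num.Theory.
Import numFieldNormedType.Exports.
Local Open Scope classical_set_scope.
Local Open Scope complex_scope.
Local Open Scope ring_scope.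

Section Defs.
Context {R : realType}.
Local Notation mu := (@lebesgue_measure R).

Definition L1 (g : R -> R) : Prop := g \in Lfun mu 1%E.
Definition L2 (g : R -> R) : Prop := g \in Lfun mu 2%:E.

Definition expi (t : R) : R[i] := cos t +i* sin t.

(* The modulus of a complex number, with values in R; the norm `|z| of
   the library lives in R[i]. *)
Definition modulus (z : R[i]) : R := complex.Re `|z|.

(* Measurability and integrals of complex-valued functions are taken
   componentwise. *)
Definition complex_measurable (G : R -> R[i]) : Prop :=
  measurable_fun [set: R] (fun x => complex.Re (G x)) /\
  measurable_fun [set: R] (fun x => complex.Im (G x)).

Definition complex_integral (G : R -> R[i]) : R[i] :=
  Rintegral mu setT (fun x => complex.Re (G x)) +i*
  Rintegral mu setT (fun x => complex.Im (G x)).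

Definition complex_L2 (G : R -> R[i]) : Prop :=
  complex_measurable G /\
  (\int[mu]_x ((modulus (G x) ^+ 2)%:E) < +oo)%E.

Definition fourier (g : R -> R) (xi : R) : R[i] :=
  complex_integral (fun x => expi (- (2 * pi * x * xi)) * (g x)%:C).

(* T is an isometry from real L^2 to complex L^2 which agrees with the Fourier
   integral on L^1 /\ L^2.  Functions, not classes, are used: the isometry
   condition makes T compatible with a.e. equality, and by density of
   L^1 /\ L^2 it determines T g up to a.e. equality for every g in L^2. *)
Definition is_plancherel (T : (R -> R) -> R -> R[i]) : Prop :=
  [/\ forall g, L2 g -> complex_L2 (T g),
      forall g h, L2 g -> L2 h ->
        (\int[mu]_xi ((modulus (T g xi - T h xi) ^+ 2)%:E) =
         \int[mu]_x (((g x - h x) ^+ 2)%:E))%E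
    & forall g, L1 g -> L2 g -> {ae mu, forall xi, T g xi = fourier g xi}].

(* The default value of xget is irrelevant, by Plancherel's theorem. *)
Definition plancherel : (R -> R) -> R -> R[i] :=
  xget (fun _ _ => 0) [set T | is_plancherel T].

Definition hatH (m : R) (w : R -> R) : Prop :=
  L2 w /\
  (\int[mu]_xi (((1 + `|2 * pi * xi| `^ (2 * m)) *
                 modulus (plancherel w xi) ^+ 2)%:E) < +oo)%E.

(* (+ 2 pi xi i)^sigma for b = false and (- 2 pi xi i)^sigma for b = true;
   only meaningful for sigma >= 0 and xi != 0. *)
Definition cpow (b : bool) (sigma xi : R) : R[i] :=
  (`|2 * pi * xi| `^ sigma)%:C *
  expi ((-1) ^+ b * (sigma * pi * Num.sg xi / 2)).

(* For r >= 0 the second branch is exactly the case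
   1/2 + 2k < r/2 < 3/2 + 2k for some natural number k. *)
Definition chi (r : R) : R :=
  if `[< (0 <= r / 2 <= 1 / 2) \/
         exists k : nat, 3 / 2 + 2 * k%:R <= r / 2 <= 5 / 2 + 2 * k%:R >]
  then 1 else -1.

End Defs.

(* Main.v *)
Require Import Defs.
From HB Require Import structures.
From mathcomp Require Import all_boot all_order all_algebra.
From mathcomp Require Import all_classical all_reals all_analysis.
From mathcomp Require Import complex measurable_realfun ring lra.

Set Implicit Arguments.
Unset Strict Implicit.
Unset Printing Implicit Defensive.
Import Order.TTheory GRing.Theory Num.Theory.
Import numFieldNormedType.Exports.
Local Open Scope classical_set_scope.
Local Open Scope complex_scope.
Local Open Scope ring_scope.

(** The function f is a Fourier multiplier, and two facts make it an
    isomorphism between the two spaces of the theorem.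

    Size.  Write rho = |2 pi xi|.  One factor has squared modulus
    1 + 2 chi(sigma) cos(theta) rho^sigma + rho^(2 sigma), with theta =
    +- sigma pi / 2 the angle of the power, and chi(sigma) is by construction
    the sign of cos(sigma pi / 2) = cos(theta).  The cross term is thus
    nonnegative and the squared modulus lies between 1 + rho^(2 sigma) and
    twice that ([factor_modulus2]).  Since
    (1 + rho^a) (1 + rho^b) and 1 + rho^(a+b) agree up to a factor 2
    ([weight_add]), multiplying over i shows that (1 + rho^(2 tau)) |f|^2 and
    1 + rho^(2 s) are comparable ([weight_prod]).  Hence v satisfies the
    integrability condition of order s exactly when f v^ satisfies the one of
    order tau.

    Range.  It remains to find, for a square integrable G = f v^, a real u
    with u^ = G.  As f and v^ commute with xi |-> - xi up to conjugation, so
    does G, and every such G is a Plancherel transform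
    ([plancherel_surjective]).  This is deduced from the three properties in
    the definition of a Plancherel transform T, which make T an isometry.
    Fubini's theorem gives the multiplication formula, int (T g) h =
    int g (T h), on integrable g and h; by density it holds on all of L^2
    ([plancherel_transpose]).  So, up to a reflection, T is its own adjoint,
    and the adjoint of an isometry applied to G is a preimage of G as soon as
    it preserves the norm of G.  Concretely, with A = Re T and B = Im T, the
    preimage is u = A (Re G) + B (Im G); the symmetries of G give
    ||u|| = ||G||, the multiplication formula gives <T u, G> = ||u||^2, and
    therefore ||T u - G||^2 = 0.

    This applies to [plancherel] as soon as some Plancherel transform exists.
    Otherwise [plancherel] is identically 0, every square integrable function
    belongs to every space considered, and u = v satisfies the equation. *)

(** Lebesgue measure is displayed as a plain set function, from which the
    generic instance does not recover the measure structure. *)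
#[local] Instance lebesgue_ae_filter (R : realType) :
  Filter (nbhs (almost_everywhere (@lebesgue_measure R))).
Proof. exact: ae_filter_ringOfSetsType. Qed.

(** * The real inner product on square integrable functions *)

Definition ip {R : realType} (g h : R -> R) : R :=
  Rintegral (@lebesgue_measure R) setT (fun x => g x * h x).

Local Notation N2 g := (ip g g).

Section L2.
Context {R : realType}.
Local Notation mu := (@lebesgue_measure R).
Implicit Types g h k : R -> R.

Lemma L2P g : L2 g <-> measurable_fun setT g /\
  (\int[mu]_x ((g x ^+ 2)%:E) < +oo)%E.
Proof.
split=> [g2|[mg g2]].
  have /integrableP[_ ig] := Lfun2_integrable_sqr g2; split.
    by move: g2; rewrite /L2 inE => /andP[/[!inE]].
  move: ig; rewrite (_ : integral _ _ _ = \int[mu]_x (g x ^+ 2)%:E)%E//.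
  by apply: eq_integral => x _; rewrite gee0_abs// lee_fin sqr_ge0.
rewrite /L2 inE; apply/andP; split; rewrite inE//=.
rewrite /finite_norm unlock /Lnorm poweR_lty//.
under eq_integral => x _ do
  rewrite poweR_EFin powR_mulrn// real_normK ?num_real//.
by [].
Qed.

Lemma L2_measurable g : L2 g -> measurable_fun setT g.
Proof. by move=> /L2P[]. Qed.

Let L2_lin (a : R) g h : L2 g -> L2 h -> L2 (a *: g + h).
Proof. by move=> Lg Lh; apply: (Lfun_submod_closed _ (lee1n 2)).2. Qed.

Lemma L2_0 : L2 (fun=> 0 : R).
Proof. exact: (Lfun_submod_closed _ (lee1n 2)).1. Qed.

Lemma L2D g h : L2 g -> L2 h -> L2 (fun x => g x + h x).
Proof.
move=> Lg Lh; have := L2_lin 1 Lg Lh; congr L2.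
by apply/funext => x /=; rewrite -[LHS]/(1 * g x + h x) mul1r.
Qed.

Lemma L2Z (a : R) g : L2 g -> L2 (fun x => a * g x).
Proof.
move=> Lg; have := L2_lin a Lg L2_0; congr L2.
by apply/funext => x /=; rewrite -[LHS]/(a * g x + 0) addr0.
Qed.

Lemma L2N g : L2 g -> L2 (fun x => - g x).
Proof.
by move=> /(L2Z (-1)); congr L2; apply/funext => x; rewrite mulN1r.
Qed.

Lemma L2B g h : L2 g -> L2 h -> L2 (fun x => g x - h x).
Proof. by move=> Lg Lh; apply: L2D => //; exact: L2N. Qed.

Lemma integrable_ip g h : L2 g -> L2 h ->
  mu.-integrable setT (EFin \o (fun x => g x * h x)).
Proof. by move=> Lg Lh; apply/Lfun1_integrable; exact: Lfun2_mul_Lfun1. Qed.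

Lemma ipC g h : ip g h = ip h g.
Proof. by apply: eq_Rintegral => x _; rewrite mulrC. Qed.

Lemma ipDl g h k : L2 g -> L2 h -> L2 k ->
  ip (fun x => g x + h x) k = ip g k + ip h k.
Proof.
move=> Lg Lh Lk; rewrite -RintegralD//; try exact: integrable_ip.
by apply: eq_Rintegral => x _; rewrite mulrDl.
Qed.

Lemma ipZl (a : R) g h : L2 g -> L2 h -> ip (fun x => a * g x) h = a * ip g h.
Proof.
move=> Lg Lh; rewrite -RintegralZl//; try exact: integrable_ip.
by apply: eq_Rintegral => x _; rewrite mulrA.
Qed.

Lemma ipBl g h k : L2 g -> L2 h -> L2 k ->
  ip (fun x => g x - h x) k = ip g k - ip h k.
Proof.
move=> Lg Lh Lk; rewrite -RintegralB//; try exact: integrable_ip.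
by apply: eq_Rintegral => x _; rewrite mulrBl.
Qed.

Lemma N2_EFin g : L2 g -> (N2 g)%:E = (\int[mu]_x ((g x ^+ 2)%:E))%E.
Proof.
move=> Lg; rewrite fineK//; first exact/integrable_fin_num/integrable_ip.
Qed.

Lemma N2_ge0 g : 0 <= N2 g.
Proof. by apply: Rintegral_ge0 => x _; rewrite -expr2 sqr_ge0. Qed.

Lemma N2B g h : L2 g -> L2 h ->
  N2 (fun x => g x - h x) = N2 g - 2 * ip g h + N2 h.
Proof.
move=> Lg Lh; have Lgh := L2B Lg Lh.
rewrite ipBl// ![ip _ (fun x => g x - h x)]ipC !ipBl// (ipC h g).
by ring.
Qed.

Lemma N2D g h : L2 g -> L2 h ->
  N2 (fun x => g x + h x) = N2 g + 2 * ip g h + N2 h.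
Proof.
move=> Lg Lh; have Lgh := L2D Lg Lh.
rewrite ipDl// ![ip _ (fun x => g x + h x)]ipC !ipDl// (ipC h g).
by ring.
Qed.

Lemma ae_eq_ip g g' h h' :
  measurable_fun setT g -> measurable_fun setT g' ->
  measurable_fun setT h -> measurable_fun setT h' ->
  {ae mu, forall x, g x = g' x} -> {ae mu, forall x, h x = h' x} ->
  ip g h = ip g' h'.
Proof.
move=> mg mg' mh mh' gg' hh'; congr fine; apply: ae_eq_integral => //.
- exact/measurable_EFinP/measurable_funM.
- exact/measurable_EFinP/measurable_funM.
- by apply: filterS2 gg' hh' => x -> ->.
Qed.

Lemma N2_eq0 g : L2 g -> N2 g = 0 -> {ae mu, forall x, g x = 0}.
Proof.
move=> Lg g0; have mg := L2_measurable Lg.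
have mg2 : measurable_fun setT (fun x => (g x ^+ 2)%:E).
  exact/measurable_EFinP/measurable_funX.
have [+ _] := ae_eq_integral_abs mu measurableT mg2.
under eq_integral do rewrite gee0_abs ?lee_fin ?sqr_ge0//.
rewrite -N2_EFin// g0 => /(_ erefl) g20.
by apply: filterS g20 => x /(_ Logic.I) /= [] /eqP; rewrite sqrf_eq0 => /eqP.
Qed.

Lemma N2B_eq0 g h : L2 g -> L2 h -> N2 (fun x => g x - h x) = 0 ->
  {ae mu, forall x, g x = h x}.
Proof.
move=> Lg Lh /(N2_eq0 (L2B Lg Lh)) gh0.
by apply: filterS gh0 => x /eqP; rewrite subr_eq0 => /eqP.
Qed.

Lemma cauchy_schwarz_ip g h : L2 g -> L2 h -> ip g h ^+ 2 <= N2 g * N2 h.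
Proof.
move=> Lg Lh; have [h0|h0] := eqVneq (N2 h) 0.
  have mg := L2_measurable Lg; have mh := L2_measurable Lh.
  rewrite (@ae_eq_ip g g h (fun=> 0))//; [|exact: aeW|exact: N2_eq0].
  rewrite h0 mulr0 /ip; under eq_Rintegral do rewrite mulr0.
  by rewrite /Rintegral integral0 expr0n.
(* Subtract from g its projection on h. *)
have hp : 0 < N2 h by rewrite lt_neqAle eq_sym h0 N2_ge0.
pose a := ip g h / N2 h; have Lah := L2Z a Lh.
have := N2_ge0 (fun x => g x - a * h x).
have gah : ip g (fun x => a * h x) = a * ip g h by rewrite ipC ipZl// ipC.
have hah : ip h (fun x => a * h x) = a * N2 h by rewrite ipC ipZl// ipC.
rewrite N2B// gah ipZl// hah.
move=> /(mulr_ge0 (ltW hp)).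
suff -> : N2 h * (N2 g - 2 * (a * ip g h) + a * (a * N2 h)) =
  N2 g * N2 h - ip g h ^+ 2 by rewrite subr_ge0.
by rewrite /a; field.
Qed.

End L2.

(** * Extension by density from integrable to square integrable functions *)

Section density.
Context {R : realType}.
Local Notation mu := (@lebesgue_measure R).
Implicit Types g h k : R -> R.

Lemma le_L2 g h : measurable_fun setT h ->
  (forall x, h x ^+ 2 <= g x ^+ 2) -> L2 g -> L2 h.
Proof.
move=> mh hg Lg; have mg := L2_measurable Lg; apply/L2P; split=> //.
have /L2P[_] := Lg; apply: le_lt_trans; apply: ge0_le_integral => //.
- by move=> x _; rewrite lee_fin sqr_ge0.
- exact/measurable_EFinP/measurable_funX.
- exact/measurable_EFinP/measurable_funX.
- by move=> x _; rewrite lee_fin.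
Qed.

Lemma L2_indic_itv (a b : R) : L2 \1_(`[a, b]%classic).
Proof.
apply/L2P; split; first exact: measurable_indic.
under eq_integral => x _.
  rewrite (_ : (_ ^+ 2)%:E = (\1_(`[a, b]%classic) x)%:E); last first.
    by rewrite indicE; case: (_ \in _); rewrite ?expr1n ?expr0n.
  over.
rewrite integral_indic// setIT.
rewrite /= lebesgue_measure_itv/=.
by case: ifPn => _; rewrite ?ltry ?ltey.
Qed.

(** The approximants are the truncations of g to the intervals [-n, n]. *)
Lemma L1_L2_dense g (e : R) : L2 g -> 0 < e ->
  exists g', [/\ L1 g', L2 g' & N2 (fun x => g x - g' x) < e].
Proof.
move=> Lg e0; have mg := L2_measurable Lg.
pose g_ n x := g x * \1_(`[- (n%:R : R), n%:R]%classic) x.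
have L1g n : L1 (g_ n) by apply: Lfun2_mul_Lfun1 => //; exact: L2_indic_itv.
have mg_ n : measurable_fun setT (g_ n).
  by apply: measurable_funM; [exact: mg|exact: measurable_indic].
have L2g n : L2 (g_ n).
  apply: le_L2 Lg => // x; rewrite /g_ indicE.
  by case: (_ \in _); rewrite ?mulr1// mulr0 expr0n sqr_ge0.
have mB n : measurable_fun setT (fun x => ((g x - g_ n x) ^+ 2)%:E).
  by apply/measurable_EFinP/measurable_funX/measurable_funB.
have [||||_ _ cv] := dominated_convergence (mu := mu) measurableT mB
  (f := cst 0%E) (g := EFin \o (fun x => g x ^+ 2)).
- exact: measurable_cst.
- apply: aeW => x _; apply: cvg_near_cst; exists (Num.truncn `|x|).+1 => //=.
  move=> n /= xn.
  rewrite /g_ indicE mem_set ?mulr1 ?subrr ?expr0n//=.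
  rewrite in_itv/= -ler_norml ltW// (lt_le_trans (truncnS_gt _))//.
  by rewrite ler_nat.
- exact: Lfun2_integrable_sqr.
- apply: aeW => x n _; rewrite gee0_abs ?lee_fin ?sqr_ge0//=.
  rewrite /g_ indicE; case: (_ \in _).
    by rewrite mulr1 subrr expr0n sqr_ge0.
  by rewrite mulr0 subr0.
move: cv; rewrite integral_cst// mul0e => /fine_cvg/cvgr_lt/(_ e e0)[n _].
move=> /(_ n (leqnn n)) gne.
by exists (g_ n); split => //; apply: le_lt_trans gne.
Qed.

(** For a map that is not assumed linear, this replaces boundedness; the real
    and imaginary parts of a Plancherel transform have this property. *)
Definition nonexpansive (F : (R -> R) -> R -> R) :=
  (forall g, L2 g -> L2 (F g)) /\
  (forall g h, L2 g -> L2 h ->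
     N2 (fun x => F g x - F h x) <= N2 (fun x => g x - h x)).

(** The hypothesis is squared so that it can be met by Cauchy-Schwarz without
    taking square roots. *)
Lemma dense_eq0 (phi : (R -> R) -> R) (C : R) :
  (forall g h, L2 g -> L2 h ->
     (phi g - phi h) ^+ 2 <= C * N2 (fun x => g x - h x)) ->
  (forall g, L1 g -> L2 g -> phi g = 0) ->
  forall g, L2 g -> phi g = 0.
Proof.
move=> phiC phi0 g Lg; apply/eqP/negPn/negP => phig.
have C0 : 0 < `|C| + 1 by rewrite ltr_wpDl.
have e0 : 0 < phi g ^+ 2 / (`|C| + 1).
  by rewrite divr_gt0// lt_neqAle eq_sym sqrf_eq0 phig sqr_ge0.
have [h [L1h L2h]] := L1_L2_dense Lg e0.
rewrite ltr_pdivlMr// ltNge => /negP; apply.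
have := phiC _ _ Lg L2h; rewrite (phi0 h)// subr0 => /le_trans; apply.
rewrite mulrC ler_wpM2l ?N2_ge0//.
by rewrite (le_trans (ler_norm _))// lerDl.
Qed.

(** The density argument is applied to one variable at a time: for a fixed h,
    both sides are continuous in g because F and G are nonexpansive. *)
Lemma ip_transpose_ext (F G : (R -> R) -> R -> R) :
  nonexpansive F -> nonexpansive G ->
  (forall g h, L1 g -> L2 g -> L1 h -> L2 h -> ip (F g) h = ip g (G h)) ->
  forall g h, L2 g -> L2 h -> ip (F g) h = ip g (G h).
Proof.
move=> [FL Fc] [GL Gc] FG.
have half g h : L2 g -> L1 h -> L2 h -> ip (F g) h = ip g (G h).
  move=> + L1h L2h; move: g.
  suff : forall g, L2 g -> ip (F g) h - ip g (G h) = 0.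
    by move=> H g Lg; apply/eqP; rewrite -subr_eq0 H.
  apply: (@dense_eq0 _ (2 * N2 h + 2 * N2 (G h))) => [g k Lg Lk|g L1g L2g].
    rewrite (_ : _ - _ = ip (fun x => F g x - F k x) h
      - ip (fun x => g x - k x) (G h)); last by rewrite !ipBl//; auto; ring.
    have c1 := cauchy_schwarz_ip (L2B (FL _ Lg) (FL _ Lk)) L2h.
    have c2 := cauchy_schwarz_ip (L2B Lg Lk) (GL _ L2h).
    have := Fc _ _ Lg Lk => /(ler_wpM2r (N2_ge0 h)).
    have := sqr_ge0 (ip (fun x => F g x - F k x) h
                     + ip (fun x => g x - k x) (G h)).
    by nra.
  by rewrite FG// subrr.
move=> g h Lg; move: h.
suff : forall h, L2 h -> ip (F g) h - ip g (G h) = 0.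
  by move=> H h Lh; apply/eqP; rewrite -subr_eq0 H.
apply: (@dense_eq0 _ (2 * N2 (F g) + 2 * N2 g)) => [h k Lh Lk|h L1h L2h].
  rewrite (_ : _ - _ = ip (fun x => h x - k x) (F g)
    - ip (fun x => G h x - G k x) g); last first.
    rewrite !ipBl//; auto; rewrite !(ipC _ (F g)) !(ipC _ g); ring.
  have c1 := cauchy_schwarz_ip (L2B Lh Lk) (FL _ Lg).
  have c2 := cauchy_schwarz_ip (L2B (GL _ Lh) (GL _ Lk)) Lg.
  have := Gc _ _ Lh Lk => /(ler_wpM2r (N2_ge0 g)).
  have := sqr_ge0 (ip (fun x => h x - k x) (F g)
                   + ip (fun x => G h x - G k x) g).
  by nra.
by rewrite half// subrr.
Qed.

(** F g and G g are compared by testing them against an arbitrary k, then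
    taking k to be their difference. *)
Lemma ae_eq_ext (F G : (R -> R) -> R -> R) :
  nonexpansive F -> nonexpansive G ->
  (forall g, L1 g -> L2 g -> {ae mu, forall x, F g x = G g x}) ->
  forall g, L2 g -> {ae mu, forall x, F g x = G g x}.
Proof.
move=> [FL Fc] [GL Gc] FG.
have H k : L2 k -> forall g, L2 g -> ip (F g) k - ip (G g) k = 0.
  move=> Lk; apply: (@dense_eq0 _ (4 * N2 k)) => [g h Lg Lh|g L1g L2g].
    rewrite (_ : _ - _ = ip (fun x => F g x - F h x) k
      - ip (fun x => G g x - G h x) k); last by rewrite !ipBl//; auto; ring.
    have c1 := cauchy_schwarz_ip (L2B (FL _ Lg) (FL _ Lh)) Lk.
    have c2 := cauchy_schwarz_ip (L2B (GL _ Lg) (GL _ Lh)) Lk.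
    have := Fc _ _ Lg Lh => /(ler_wpM2r (N2_ge0 k)).
    have := Gc _ _ Lg Lh => /(ler_wpM2r (N2_ge0 k)).
    have := sqr_ge0 (ip (fun x => F g x - F h x) k
                     + ip (fun x => G g x - G h x) k).
    by nra.
  have mF := L2_measurable (FL _ L2g); have mG := L2_measurable (GL _ L2g).
  have mk := L2_measurable Lk; rewrite (ae_eq_ip mF mG mk mk) ?subrr//.
    exact: FG.
  exact: aeW.
move=> g Lg; have LB := L2B (FL _ Lg) (GL _ Lg).
by apply: N2B_eq0; auto; rewrite ipBl//; auto; exact: H.
Qed.

End density.

(** * Reflection and integral kernels *)

Section reflection.
Context {R : realType}.
Local Notation mu := (@lebesgue_measure R).
Implicit Types g h k : R -> R.

Lemma integral_refl (f : R -> \bar R) : measurable_fun setT f ->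
  (\int[mu]_x f (- x)%R = \int[mu]_x f x)%E.
Proof.
move=> mf.
have ge0_refl (k : R -> \bar R) : measurable_fun setT k ->
    (forall x, 0 <= k x)%E -> (\int[mu]_x k (- x)%R = \int[mu]_x k x)%E.
  move=> mk k0; rewrite -[LHS](@ge0_integral_pushforward _ _ _ _ _
    (-%R : measurableTypeR R -> measurableTypeR R) _ mu setT)//.
  by apply: eq_measure_integral => A mA _; exact: lebesgue_measureN.
rewrite integralE [RHS]integralE; congr (_ - _)%E.
- rewrite -[RHS](ge0_refl f^\+%E)//; last exact: measurable_funepos.
  by apply: eq_integral => x _; rewrite /= unlock.
- rewrite -[RHS](ge0_refl f^\-%E)//; last exact: measurable_funeneg.
  by apply: eq_integral => x _; rewrite /= unlock.
Qed.

Lemma ae_refl (P : R -> Prop) :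
  {ae mu, forall x, P x} -> {ae mu, forall x, P (- x)}.
Proof.
move=> [N [mN N0 PN]]; exists (-%R @^-1` N); split.
- by rewrite -[X in measurable X]setTI; exact: oppr_measurable.
- by rewrite -N0; exact: lebesgue_measureN.
- by move=> x /= nPx; apply: PN.
Qed.

Lemma measurable_refl g : measurable_fun setT g ->
  measurable_fun setT (fun x : R => g (- x)).
Proof. by move=> mg; apply: measurableT_comp. Qed.

Lemma L2_refl g : L2 g -> L2 (fun x : R => g (- x)).
Proof.
move=> /L2P[mg g2]; apply/L2P; split; first exact: measurable_refl.
rewrite (integral_refl (f := fun x : R => (g x ^+ 2)%:E))//.
exact/measurable_EFinP/measurable_funX.
Qed.

Lemma ip_refl g h : measurable_fun setT g -> measurable_fun setT h ->
  ip (fun x : R => g (- x)) (fun x : R => h (- x)) = ip g h.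
Proof.
move=> mg mh; congr fine.
rewrite (integral_refl (f := fun x : R => (g x * h x)%:E))//.
exact/measurable_EFinP/measurable_funM.
Qed.

(** The reflection preserves the integral and changes the sign of g h. *)
Lemma ip_even_odd g h : L2 g -> L2 h ->
  {ae mu, forall x, g (- x) = g x} -> {ae mu, forall x, h (- x) = - h x} ->
  ip g h = 0.
Proof.
move=> Lg Lh ge ho; have mg := L2_measurable Lg; have mh := L2_measurable Lh.
have : ip g h = - ip g h.
  rewrite -[LHS]ip_refl// (ae_eq_ip _ _ _ _ ge ho)//.
  - rewrite ipC (_ : (fun x => - h x) = (fun x => -1 * h x)); last first.
      by apply/funext => x; rewrite mulN1r.
    by rewrite ipZl// mulN1r ipC.
  - exact: measurable_refl.
  - exact: measurable_refl.
  - exact: measurableT_comp.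
by lra.
Qed.

Lemma integrable_bounded_mul (L k : R -> R) : measurable_fun setT L ->
  (forall x, `|L x| <= 1) -> L1 k ->
  mu.-integrable setT (EFin \o (fun x => L x * k x)).
Proof.
move=> mL L1 /Lfun1_integrable ik.
have mk : measurable_fun setT k by case/integrableP: ik => /measurable_EFinP.
apply: (le_integrable _ _ _ ik) => //.
  exact/measurable_EFinP/measurable_funM.
by move=> x _; rewrite /= lee_fin normrM ler_piMl.
Qed.

Lemma Fubini_kernel (K : R * R -> R) g h :
  measurable_fun setT K -> (forall z, `|K z| <= 1) -> L1 g -> L1 h ->
  ip (fun y => Rintegral mu setT (fun x => K (y, x) * g x)) h =
  ip g (fun x => Rintegral mu setT (fun y => K (y, x) * h y)).
Proof.
move=> mK K1 L1g L1h.
have /Lfun1_integrable ig := L1g; have /Lfun1_integrable ih := L1h.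
pose f z : \bar R := (K z * (h z.1 * g z.2))%:E.
have mg : measurable_fun setT g by case/integrableP: ig => /measurable_EFinP.
have mh : measurable_fun setT h by case/integrableP: ih => /measurable_EFinP.
have mf : measurable_fun setT f.
  apply/measurable_EFinP/measurable_funM => //; apply: measurable_funM.
    exact: (measurableT_comp mh measurable_fst).
  exact: (measurableT_comp mg measurable_snd).
have mKl x : measurable_fun setT (fun y => K (y, x)).
  exact: (measurableT_comp mK (measurable_pair2 x)).
have mKr y : measurable_fun setT (fun x => K (y, x)).
  exact: (measurableT_comp mK (measurable_pair1 y)).
have ihg : (mu \x mu)%E.-integrable setT
    (fun z : R * R => (h z.1 * g z.2)%:E).
  apply/integrable12ltyP.
    apply/measurable_EFinP/measurable_funM.
      exact: (measurableT_comp mh measurable_fst).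
    exact: (measurableT_comp mg measurable_snd).
  under eq_integral => y _.
    under eq_integral do rewrite /= normrM EFinM.
    rewrite ge0_integralZl//; [|exact/measurable_EFinP/measurableT_comp].
    over.
  have /integrableP[_ /= lh] := ih; have /integrableP[_ /= lg] := ig.
  rewrite /= ge0_integralZr//; last 2 first.
  - exact/measurable_EFinP/measurableT_comp.
  - exact: integral_ge0.
  by rewrite lte_mul_pinfty ?ge0_fin_numE ?integral_ge0.
have if_ : (mu \x mu)%E.-integrable setT f.
  apply: (le_integrable _ _ _ ihg) => //.
  by move=> x _; rewrite /= lee_fin normrM ler_piMl.
have FE y : ((Rintegral mu setT (fun x => K (y, x) * g x) * h y)%:E =
    \int[mu]_x f (y, x))%E.
  have iKg := integrable_bounded_mul (mKr y) (fun x => K1 (y, x)) L1g.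
  rewrite mulrC EFinM fineK; last exact: integrable_fin_num.
  by rewrite -integralZl//; apply: eq_integral => x _; rewrite -EFinM mulrCA.
have GE x : ((g x * Rintegral mu setT (fun y => K (y, x) * h y))%:E =
    \int[mu]_y f (y, x))%E.
  have iKh := integrable_bounded_mul (mKl x) (fun y => K1 (y, x)) L1h.
  rewrite EFinM fineK; last exact: integrable_fin_num.
  rewrite -integralZl//; apply: eq_integral => y _; rewrite -EFinM.
  by congr EFin; rewrite /=; ring.
congr fine; transitivity (\int[mu]_y \int[mu]_x f (y, x))%E.
  by apply: eq_integral => y _; rewrite FE.
by rewrite (Fubini if_); apply: eq_integral => x _; rewrite GE.
Qed.

Lemma measurable_kernel_integral (K : R * R -> R) g :
  measurable_fun setT K -> measurable_fun setT g ->
  measurable_fun setT (fun y => Rintegral mu setT (fun x => K (y, x) * g x)).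
Proof.
move=> mK mg; pose f z : \bar R := (K z * g z.2)%:E.
have mf : measurable_fun setT f.
  apply/measurable_EFinP/measurable_funM => //.
  exact: (measurableT_comp mg measurable_snd).
apply: (measurableT_comp (@fine_measurable R setT measurableT)).
rewrite (_ : (fun y => _) = (fun y => \int[mu]_x (f^\+ (y, x)) -
    \int[mu]_x (f^\- (y, x))))%E; last first.
  apply/funext => y; rewrite integralE; congr (_ - _)%E.
    by apply: eq_integral => x _; rewrite !funeposE.
  by apply: eq_integral => x _; rewrite !funenegE.
apply: emeasurable_funB; apply: measurable_fun_fubini_tonelli_F => //.
  exact: measurable_funepos.
exact: measurable_funeneg.
Qed.

(** A bounded symmetric kernel defines a symmetric operator on integrable
    functions, by Fubini; this carries over to any nonexpansive extension to
    square integrable functions. *)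
Lemma ip_transpose_kernel (K : R * R -> R) (F : (R -> R) -> R -> R) :
  measurable_fun setT K -> (forall z, `|K z| <= 1) ->
  (forall x y, K (x, y) = K (y, x)) -> nonexpansive F ->
  (forall g, L1 g -> L2 g -> {ae mu, forall y, F g y =
     Rintegral mu setT (fun x => K (y, x) * g x)}) ->
  forall g h, L2 g -> L2 h -> ip (F g) h = ip g (F h).
Proof.
move=> mK K1 Ksym nF FK; apply: ip_transpose_ext => // g h L1g L2g L1h L2h.
have [mg mh] := (L2_measurable L2g, L2_measurable L2h).
have mFK k : L2 k -> measurable_fun setT (F k) /\
    measurable_fun setT (fun y => Rintegral mu setT (fun x => K (y, x) * k x)).
  move=> Lk; split; first exact: (L2_measurable (nF.1 _ Lk)).
  exact: (measurable_kernel_integral mK (L2_measurable Lk)).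
have [mFg mKg] := mFK _ L2g; have [mFh mKh] := mFK _ L2h.
rewrite (ae_eq_ip mFg mKg mh mh (FK _ L1g L2g)); last exact: aeW.
rewrite [RHS](ae_eq_ip mg mg mFh mKh _ (FK _ L1h L2h)); last exact: aeW.
rewrite Fubini_kernel//; congr ip; apply/funext => x.
by apply: eq_Rintegral => y _; rewrite Ksym.
Qed.

End reflection.

(** * The range of a Plancherel transform *)

Section plancherel.
Context {R : realType}.
Local Notation mu := (@lebesgue_measure R).
Implicit Types (g h : R -> R) (T : (R -> R) -> R -> R[i]) (z : R[i]).

Lemma modulus2 z : modulus z ^+ 2 = complex.Re z ^+ 2 + complex.Im z ^+ 2.
Proof. by rewrite /modulus normc_def /= sqr_sqrtr// addr_ge0 ?sqr_ge0. Qed.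

Lemma ReB z w : complex.Re (z - w) = complex.Re z - complex.Re w.
Proof. by case: z w => [a b] [c d]. Qed.

Lemma ImB z w : complex.Im (z - w) = complex.Im z - complex.Im w.
Proof. by case: z w => [a b] [c d]. Qed.

Lemma complex_L2P (G : R -> R[i]) : complex_L2 G <->
  L2 (fun x => complex.Re (G x)) /\ L2 (fun x => complex.Im (G x)).
Proof.
have sq (k : R -> R) : measurable_fun setT k ->
    measurable_fun setT (fun x => (k x ^+ 2)%:E).
  by move=> mk; exact/measurable_EFinP/measurable_funX.
split=> [[[mr mi] G2]|[/L2P[mr r2] /L2P[mi i2]]].
  have mG : measurable_fun setT (fun x => (modulus (G x) ^+ 2)%:E).
    under eq_fun do rewrite modulus2.
    by apply/measurable_EFinP/measurable_funD; exact: measurable_funX.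
  split; apply/L2P; split=> //; apply: le_lt_trans G2;
    apply: ge0_le_integral => //; try exact: sq;
    by move=> x _; rewrite lee_fin ?modulus2 ?lerDl ?lerDr ?sqr_ge0.
split=> //; under eq_integral do rewrite modulus2 EFinD.
rewrite ge0_integralD//; first exact: lte_add_pinfty.
- by move=> x _; rewrite lee_fin sqr_ge0.
- exact: sq.
- by move=> x _; rewrite lee_fin sqr_ge0.
- exact: sq.
Qed.

Lemma plancherel_L2 T g : is_plancherel T -> L2 g ->
  L2 (fun x => complex.Re (T g x)) /\ L2 (fun x => complex.Im (T g x)).
Proof. by move=> [TL _ _] Lg; apply/complex_L2P; exact: TL. Qed.

Lemma plancherel_isometry T g h : is_plancherel T -> L2 g -> L2 h ->
  N2 (fun x => complex.Re (T g x) - complex.Re (T h x)) +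
  N2 (fun x => complex.Im (T g x) - complex.Im (T h x)) =
  N2 (fun x => g x - h x).
Proof.
move=> hT Lg Lh; have [_ iso _] := hT.
have [Lgr Lgi] := plancherel_L2 hT Lg; have [Lhr Lhi] := plancherel_L2 hT Lh.
have Lr := L2B Lgr Lhr; have Li := L2B Lgi Lhi.
apply: EFin_inj; rewrite EFinD !N2_EFin//; last exact: L2B.
have sq (k : R -> R) : L2 k -> measurable_fun setT (fun x => (k x ^+ 2)%:E).
  by move=> /L2_measurable mk; exact/measurable_EFinP/measurable_funX.
rewrite -(iso _ _ Lg Lh) -ge0_integralD//; try exact: sq;
  try by move=> x _; rewrite lee_fin sqr_ge0.
by apply: eq_integral => x _; rewrite modulus2 ReB ImB.
Qed.

Lemma nonexpansive_Re T : is_plancherel T ->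
  nonexpansive (fun g x => complex.Re (T g x)).
Proof.
move=> hT; split=> [g /(plancherel_L2 hT)[]//|g h Lg Lh].
by rewrite -(plancherel_isometry hT Lg Lh) lerDl N2_ge0.
Qed.

Lemma nonexpansive_Im T : is_plancherel T ->
  nonexpansive (fun g x => complex.Im (T g x)).
Proof.
move=> hT; split=> [g /(plancherel_L2 hT)[]//|g h Lg Lh].
by rewrite -(plancherel_isometry hT Lg Lh) lerDr N2_ge0.
Qed.

Lemma nonexpansive_refl (F : (R -> R) -> R -> R) : nonexpansive F ->
  nonexpansive (fun g x => F g (- x)).
Proof.
move=> [FL Fc]; split=> [g Lg|g h Lg Lh]; first exact/L2_refl/FL.
have LB := L2_measurable (L2B (FL _ Lg) (FL _ Lh)).
by apply: le_trans (Fc _ _ Lg Lh); rewrite (ip_refl LB LB).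
Qed.

Lemma nonexpansive_opp (F : (R -> R) -> R -> R) : nonexpansive F ->
  nonexpansive (fun g x => - F g x).
Proof.
move=> [FL Fc]; split=> [g Lg|g h Lg Lh]; first exact/L2N/FL.
apply: le_trans (Fc _ _ Lg Lh); rewrite le_eqVlt; apply/orP; left; apply/eqP.
by apply: eq_Rintegral => x _; ring.
Qed.

Lemma Re_fourier g xi : complex.Re (fourier g xi) =
  Rintegral mu setT (fun x => cos (2 * pi * x * xi) * g x).
Proof. by apply: eq_Rintegral => x _ /=; rewrite cosN; ring. Qed.

Lemma Im_fourier g xi : complex.Im (fourier g xi) =
  Rintegral mu setT (fun x => - sin (2 * pi * x * xi) * g x).
Proof. by apply: eq_Rintegral => x _ /=; rewrite sinN; ring. Qed.

Lemma plancherel_fourier T g : is_plancherel T -> L1 g -> L2 g ->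
  {ae mu, forall x, complex.Re (T g x) =
     Rintegral mu setT (fun y => cos (2 * pi * y * x) * g y)} /\
  {ae mu, forall x, complex.Im (T g x) =
     Rintegral mu setT (fun y => - sin (2 * pi * y * x) * g y)}.
Proof.
move=> [_ _ TF] L1g L2g; have Tg := TF _ L1g L2g.
split; apply: filterS Tg => x ->; first exact: Re_fourier.
exact: Im_fourier.
Qed.

Lemma measurable_phase :
  measurable_fun setT (fun z : R * R => 2 * pi * z.1 * z.2).
Proof.
apply: measurable_funM; last exact: measurable_snd.
by apply: measurable_funM => //; exact: measurable_fst.
Qed.

Lemma measurable_cos_phase :
  measurable_fun setT (fun z : R * R => cos (2 * pi * z.1 * z.2)).
Proof.
apply: (measurableT_comp _ measurable_phase).
by apply: continuous_measurable_fun; exact: continuous_cos.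
Qed.

Lemma measurable_sin_phase :
  measurable_fun setT (fun z : R * R => - sin (2 * pi * z.1 * z.2)).
Proof.
apply: measurableT_comp => //; apply: (measurableT_comp _ measurable_phase).
by apply: continuous_measurable_fun; exact: continuous_sin.
Qed.

(** For integrable g this is read off the Fourier integral of a real function;
    both sides are nonexpansive in g, so it extends. *)
Lemma plancherel_hermitian T g : is_plancherel T -> L2 g ->
  {ae mu, forall x, complex.Re (T g (- x)) = complex.Re (T g x)} /\
  {ae mu, forall x, complex.Im (T g (- x)) = - complex.Im (T g x)}.
Proof.
move=> hT Lg; split; move: g Lg.
  apply: (ae_eq_ext (nonexpansive_refl (nonexpansive_Re hT))
                    (nonexpansive_Re hT)) => g L1g L2g.
  have [Tg _] := plancherel_fourier hT L1g L2g.
  apply: filterS2 (ae_refl Tg) Tg => x -> ->.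
  by apply: eq_Rintegral => y _; rewrite mulrN cosN.
apply: (ae_eq_ext (nonexpansive_refl (nonexpansive_Im hT))
                  (nonexpansive_opp (nonexpansive_Im hT))) => g L1g L2g.
have [_ Tg] := plancherel_fourier hT L1g L2g.
apply: filterS2 (ae_refl Tg) Tg => x -> ->.
have iS := integrable_bounded_mul
  (measurableT_comp measurable_sin_phase (measurable_pair2 x)) _ L1g.
rewrite -[RHS]mulN1r -RintegralZl//; last first.
  by apply: iS => y; rewrite normrN sin_max.
by apply: eq_Rintegral => y _; rewrite mulrN sinN; ring.
Qed.

(** The multiplication formula, split into real and imaginary parts: both
    kernels cos(2 pi x y) and - sin(2 pi x y) are symmetric. *)
Lemma plancherel_transpose T g h : is_plancherel T -> L2 g -> L2 h ->
  ip (fun x => complex.Re (T g x)) h = ip g (fun x => complex.Re (T h x)) /\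
  ip (fun x => complex.Im (T g x)) h = ip g (fun x => complex.Im (T h x)).
Proof.
move=> hT Lg Lh; split.
  apply: (ip_transpose_kernel (F := fun k x => complex.Re (T k x))
    measurable_cos_phase) => //.
  - by move=> z; rewrite cos_max.
  - by move=> x y /=; congr cos; ring.
  - exact: nonexpansive_Re.
  - move=> k L1k L2k; have [Tk _] := plancherel_fourier hT L1k L2k.
    apply: filterS Tk => x ->; apply: eq_Rintegral => y _ /=.
    by congr (cos _ * _); ring.
apply: (ip_transpose_kernel (F := fun k x => complex.Im (T k x))
  measurable_sin_phase) => //.
- by move=> z; rewrite normrN sin_max.
- by move=> x y /=; congr (- sin _); ring.
- exact: nonexpansive_Im.
- move=> k L1k L2k; have [_ Tk] := plancherel_fourier hT L1k L2k.
  apply: filterS Tk => x ->; apply: eq_Rintegral => y _ /=.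
  by congr (- sin _ * _); ring.
Qed.

(** Compare g with 0, whose transform is given by the Fourier integral. *)
Lemma plancherel_N2 T g : is_plancherel T -> L2 g ->
  N2 (fun x => complex.Re (T g x)) + N2 (fun x => complex.Im (T g x)) = N2 g.
Proof.
move=> hT Lg; pose z : R -> R := fun=> 0.
have L1z : L1 z by apply/Lfun1_integrable; exact: integrable0.
have Lz : L2 z by exact: L2_0.
have [Lgr Lgi] := plancherel_L2 hT Lg; have [Lzr Lzi] := plancherel_L2 hT Lz.
have [Tr Ti] := plancherel_fourier hT L1z Lz.
have int0 (k : R -> R) : Rintegral mu setT (fun y => k y * z y) = 0.
  by under eq_Rintegral do rewrite mulr0; rewrite /Rintegral integral0.
have := plancherel_isometry hT Lg Lz.
have -> : N2 (fun x => g x - z x) = N2 g.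
  by apply: eq_Rintegral => x _; rewrite subr0.
have sub0 k l : L2 k -> L2 l -> {ae mu, forall x, l x = 0} ->
    N2 (fun x => k x - l x) = N2 k.
  move=> Lk Ll l0; have mk := L2_measurable Lk.
  have mkl := L2_measurable (L2B Lk Ll).
  have kl : {ae mu, forall x, k x - l x = k x}.
    by apply: filterS l0 => x ->; rewrite subr0.
  exact: ae_eq_ip.
rewrite !sub0//.
- by apply: filterS Ti => x ->; exact: int0.
- by apply: filterS Tr => x ->; exact: int0.
Qed.

(** Conjugation symmetry is thus the only restriction on the range of T.  The
    preimage is the adjoint of T applied to G; the symmetry of G is what makes
    it real and of the same norm as G. *)
Lemma plancherel_surjective T (G : R -> R[i]) : is_plancherel T ->
  complex_L2 G ->
  {ae mu, forall x, G (- x) = (G x)^*%C} ->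
  exists2 u, L2 u & {ae mu, forall x, G x = T u x}.
Proof.
move=> hT /complex_L2P[].
set G1 := fun x => complex.Re (G x); set G2 := fun x => complex.Im (G x).
move=> LG1 LG2 GJ.
have Geven : {ae mu, forall x, G1 (- x) = G1 x}.
  by apply: filterS GJ => x; rewrite /G1 => ->; case: (G x).
have Godd : {ae mu, forall x, G2 (- x) = - G2 x}.
  by apply: filterS GJ => x; rewrite /G2 => ->; case: (G x).
have Lr g : L2 g -> L2 (fun x => complex.Re (T g x)) by case/(plancherel_L2 hT).
have Li g : L2 g -> L2 (fun x => complex.Im (T g x)) by case/(plancherel_L2 hT).
have N2T g : L2 g -> N2 (fun x => complex.Re (T g x)) +
    N2 (fun x => complex.Im (T g x)) = N2 g by exact: plancherel_N2.
(* An odd function pairs to 0 with the even function Re G. *)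
have IG1 : N2 (fun x => complex.Im (T G1 x)) = 0.
  have [_ ->] := plancherel_transpose hT LG1 (Li _ LG1).
  apply: ip_even_odd; auto.
  by have [] := plancherel_hermitian hT (Li _ LG1).
have RG2 : N2 (fun x => complex.Re (T G2 x)) = 0.
  have [-> _] := plancherel_transpose hT LG2 (Lr _ LG2).
  rewrite ipC; apply: ip_even_odd; auto.
  by have [] := plancherel_hermitian hT (Lr _ LG2).
have cross :
    ip (fun x => complex.Re (T G1 x)) (fun x => complex.Im (T G2 x)) = 0.
  apply: ip_even_odd; auto.
    by have [] := plancherel_hermitian hT LG1.
  by have [] := plancherel_hermitian hT LG2.
pose u x := complex.Re (T G1 x) + complex.Im (T G2 x).
have Lu : L2 u by apply: L2D; auto.
have N2u : N2 u = N2 G1 + N2 G2.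
  rewrite N2D; auto; rewrite cross -(N2T _ LG1) -(N2T _ LG2) IG1 RG2; ring.
have TuG : ip (fun x => complex.Re (T u x)) G1 +
    ip (fun x => complex.Im (T u x)) G2 = N2 u.
  have [-> _] := plancherel_transpose hT Lu LG1.
  have [_ ->] := plancherel_transpose hT Lu LG2.
  by rewrite ![ip u _]ipC -ipDl; auto.
have dist0 : N2 (fun x => complex.Re (T u x) - G1 x) +
    N2 (fun x => complex.Im (T u x) - G2 x) = 0.
  by rewrite !N2B; auto; have := N2T _ Lu; lra.
have /eqP := dist0; rewrite paddr_eq0 ?N2_ge0// => /andP[/eqP d1 /eqP d2].
exists u => //.
have e1 := N2B_eq0 (Lr _ Lu) LG1 d1; have e2 := N2B_eq0 (Li _ Lu) LG2 d2.
apply: filterS2 e1 e2 => x; rewrite /G1 /G2.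
by case: (T u x) (G x) => [a b] [c d] /= -> ->.
Qed.

End plancherel.

(** * Size, symmetry and measurability of the symbol *)

Section symbol.
Context {R : realType}.
Local Notation mu := (@lebesgue_measure R).

Lemma cos_shift_ge0 (k : nat) (t : R) :
  `|t - 2 * k%:R| <= 1 / 2 -> 0 <= cos (t * pi).
Proof.
rewrite ler_norml; set y := t - 2 * k%:R => /andP[y1 y2].
rewrite (_ : t * pi = y * pi + (pi *+ 2) *+ k); last first.
  by rewrite -[_ *+ k]mulr_natr -[pi *+ 2]mulr_natr /y; ring.
rewrite (periodicn (@cosD2pi R)); apply: cos_ge0_pihalf.
have pi0 := pi_ge0 R.
have ya : 0 <= (y + 1 / 2) * pi by apply: mulr_ge0 => //; lra.
have yb : 0 <= (1 / 2 - y) * pi by apply: mulr_ge0 => //; lra.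
by apply/andP; split; lra.
Qed.

(** The defining property of chi: it is the sign that makes this product
    nonnegative. *)
Lemma chi_cos_ge0 (r : R) : 0 <= r -> 0 <= chi r * cos (r * pi / 2).
Proof.
move=> r0; rewrite /chi (_ : r * pi / 2 = r / 2 * pi); last by ring.
case: asboolP => [H|H]; last first.
  rewrite mulN1r; pose t := r / 2 - 1.
  rewrite (_ : r / 2 * pi = t * pi + pi); last by rewrite /t; ring.
  (* Take k with 2 k <= r / 2 - 1 / 2 < 2 k + 2; as r / 2 is not in the k-th
     interval where chi is 1, it is within 1 / 2 of 2 k + 1. *)
  rewrite cosDpi opprK.
  have rh : 1 / 2 < r / 2.
    by rewrite ltNge; apply/negP => rh; apply: H; left; rewrite rh andbT; lra.
  have [k k1 k2] : exists2 k : nat, 2 * k%:R <= r / 2 - 1 / 2 &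
      r / 2 - 1 / 2 < 2 * k%:R + 2.
    exists (Num.truncn ((r / 2 - 1 / 2) / 2));
      have /andP[k1 k2] := @truncn_itv R ((r / 2 - 1 / 2) / 2) ltac:(lra);
      rewrite -[(Num.truncn _).+1%:R]natr1 in k2; lra.
  apply: (@cos_shift_ge0 k); rewrite ler_norml /t.
  have k3 : r / 2 < 3 / 2 + 2 * k%:R.
    rewrite ltNge; apply/negP => k3; apply: H; right; exists k.
    by rewrite k3 /=; lra.
  by lra.
rewrite mul1r; case: H => [|[k]] /andP[h1 h2].
  by apply: (@cos_shift_ge0 0); rewrite ler_norml; lra.
by apply: (@cos_shift_ge0 k.+1); rewrite ler_norml -[k.+1%:R]natr1; lra.
Qed.

Lemma chi_sqr (r : R) : chi r ^+ 2 = 1.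
Proof. by rewrite /chi; case: ifP => _; rewrite ?sqrrN expr1n. Qed.

Definition symbol_factor (b : bool) (sigma xi : R) : R[i] :=
  1 + (chi sigma)%:C * cpow b sigma xi.

(** Expanding the square leaves the cross term 2 chi cos(theta) rho^sigma,
    which is between 0 and 2 rho^sigma, hence at most 1 + rho^(2 sigma).  At
    xi = 0, where the angle is not +- sigma pi / 2, the cross term vanishes
    unless sigma = 0. *)
Lemma factor_modulus2 b (sigma xi : R) : 0 <= sigma ->
  1 + `|2 * pi * xi| `^ (2 * sigma) <=
  modulus (symbol_factor b sigma xi) ^+ 2 <=
  2 * (1 + `|2 * pi * xi| `^ (2 * sigma)).
Proof.
move=> s0; set rho := `|2 * pi * xi|.
pose th := (-1) ^+ b * (sigma * pi * Num.sg xi / 2) : R.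
have -> : rho `^ (2 * sigma) = (rho `^ sigma) ^+ 2.
  by rewrite mulrC powRrM powR_mulrn ?powR_ge0.
set p := rho `^ sigma; set c := chi sigma.
have -> : modulus (symbol_factor b sigma xi) ^+ 2 =
    1 + p ^+ 2 + 2 * (c * cos th * p).
  rewrite modulus2 /symbol_factor /cpow /expi -/rho -/th -/p -/c /=.
  have := chi_sqr sigma; have := cos2Dsin2 th; rewrite -/c => cs c2.
  transitivity (1 + c ^+ 2 * p ^+ 2 * (cos th ^+ 2 + sin th ^+ 2)
    + 2 * (c * cos th * p)); first by ring.
  by rewrite cs c2; ring.
have cp : 0 <= c * cos th * p.
  have [x0|x0] := boolP ((xi == 0) && (sigma != 0)).
    move: x0 => /andP[/eqP x0 s1].
    by rewrite /p /rho x0 mulr0 normr0 powR0 ?mulr0.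
  apply: mulr_ge0; last exact: powR_ge0.
  have -> : cos th = cos (sigma * pi / 2); last exact: chi_cos_ge0.
  have -> : th = (-1) ^+ b * (Num.sg xi * (sigma * pi / 2)).
    by rewrite /th; ring.
  have [->|s1] := eqVneq sigma 0; first by rewrite !mul0r !mulr0.
  have [sg1|sg1] : Num.sg xi = 1 \/ Num.sg xi = -1.
  - by move: x0; rewrite s1 andbT; case: ltrgt0P => // [/gtr0_sg|/ltr0_sg];
      [left|right].
  - rewrite sg1; case: (b); rewrite ?expr0 ?expr1 ?mulN1r ?mul1r ?cosN//.
  - rewrite sg1; case: (b);
    by rewrite ?expr0 ?expr1 ?mul1r !mulN1r ?opprK ?cosN.
have p0 : 0 <= p by exact: powR_ge0.
have ccp : c * cos th * p <= p.
  rewrite -[leRHS]mul1r ler_wpM2r//.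
  rewrite (le_trans (ler_norm _))// normrM.
  have -> : `|c| = 1 by rewrite /c /chi; case: ifP => _; rewrite ?normrN normr1.
  by rewrite mul1r cos_max.
have := sqr_ge0 (p - 1); rewrite sqrrB1 => p1.
by apply/andP; split; lra.
Qed.

(** Unlike the general rule for sums of exponents, this one includes the base
    0, since 0 to the power 0 is 1. *)
Lemma powRD_ge0 (x a b : R) : 0 <= a -> 0 <= b ->
  x `^ (a + b) = x `^ a * x `^ b.
Proof.
move=> a0 b0; have [ab0|ab0] := eqVneq (a + b) 0; last first.
  by rewrite powRD// (negbTE ab0).
have [-> ->] : a = 0 /\ b = 0 by split; lra.
by rewrite addr0 powRr0 mulr1.
Qed.

(** With x and y the two powers in the middle term, the upper bound amounts to
    0 <= (x - 1) (y - 1), which holds because x and y are on the same side of 1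
    as rho. *)
Lemma weight_add (rho a b : R) : 0 <= rho -> 0 <= a -> 0 <= b ->
  1 + rho `^ (2 * (a + b)) <= (1 + rho `^ (2 * a)) * (1 + rho `^ (2 * b)) <=
  2 * (1 + rho `^ (2 * (a + b))).
Proof.
move=> rho0 a0 b0; rewrite mulrDr powRD_ge0 ?mulr_ge0//.
set x := rho `^ (2 * a); set y := rho `^ (2 * b).
have x0 : 0 <= x by exact: powR_ge0.
have y0 : 0 <= y by exact: powR_ge0.
suff xy : 0 <= (x - 1) * (y - 1) by apply/andP; split; lra.
have [r1|/ltW r1] := leP 1 rho.
  by rewrite mulr_ge0// subr_ge0 -[leLHS](powRr0 rho) ler_powR// mulr_ge0.
have le1 (c : R) : 0 <= c -> rho `^ c <= 1.
  move=> c0; have : rho `^ c <= 1 `^ c by rewrite ge0_ler_powR// nnegrE.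
  by rewrite powR1.
by rewrite -mulrNN mulr_ge0// oppr_ge0 subr_le0 le1// mulr_ge0.
Qed.

(** The extra weight of order t makes the lower bound hold with constant 1 also
    for the empty product, and it absorbs the factors one by one: in the
    induction t becomes t + a i. *)
Lemma weight_prod (I : Type) (r : seq I) (a M : I -> R) (rho t : R) :
  0 <= rho -> 0 <= t -> (forall i, 0 <= a i) ->
  (forall i, 1 + rho `^ (2 * a i) <= M i <= 2 * (1 + rho `^ (2 * a i))) ->
  1 + rho `^ (2 * (t + \sum_(i <- r) a i)) <=
    (1 + rho `^ (2 * t)) * \prod_(i <- r) M i <=
  4 ^+ size r * (1 + rho `^ (2 * (t + \sum_(i <- r) a i))).
Proof.
move=> rho0 + a0 aM.
have w0 (c : R) : 0 < 1 + rho `^ c by rewrite ltr_wpDr ?powR_ge0.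
have M0 i : 0 <= M i by have /andP[+ _] := aM i; apply: le_trans; exact: ltW.
elim: r t => [|i r IH] t t0.
  by rewrite !big_nil addr0 mulr1 expr0 mul1r lexx.
rewrite !big_cons addrA /= exprS.
have /andP[IH1 IH2] := IH (t + a i) (addr_ge0 t0 (a0 i)).
have /andP[w1 w2] := weight_add rho0 t0 (a0 i); have /andP[m1 m2] := aM i.
have P0 : 0 <= \prod_(j <- r) M j by apply: prodr_ge0.
apply/andP; split.
  apply: le_trans IH1 _; rewrite mulrA ler_wpM2r//.
  by apply: le_trans w1 _; rewrite ler_wpM2l// ltW.
rewrite -mulrA; apply: le_trans (ler_wpM2l _ IH2) => //.
rewrite mulrA [leRHS]mulrA ler_wpM2r//.
apply: (@le_trans _ _ ((1 + rho `^ (2 * t)) * (2 * (1 + rho `^ (2 * a i))))).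
  by rewrite ler_wpM2l// ltW.
by lra.
Qed.

Lemma factor_conj b (sigma xi : R) :
  symbol_factor b sigma (- xi) = (symbol_factor b sigma xi)^*%C.
Proof.
rewrite /symbol_factor /cpow mulrN normrN sgrN.
rewrite (_ : _ * (_ * - _ / 2) = - ((-1) ^+ b * (sigma * pi * Num.sg xi / 2)));
  last by ring.
by rewrite /expi cosN sinN; apply/eqP; rewrite eq_complex /=;
  apply/andP; split; apply/eqP; ring.
Qed.

Lemma complex_measurableM (G H : R -> R[i]) :
  complex_measurable G -> complex_measurable H ->
  complex_measurable (fun x => G x * H x).
Proof.
move=> [Gr Gi] [Hr Hi]; split.
  rewrite (_ : (fun x => _) = (fun x => complex.Re (G x) * complex.Re (H x) -
    complex.Im (G x) * complex.Im (H x))); last first.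
    by apply/funext => x; case: (G x) (H x) => [a b] [c d].
  by apply: measurable_funB; exact: measurable_funM.
rewrite (_ : (fun x => _) = (fun x => complex.Re (G x) * complex.Im (H x) +
  complex.Im (G x) * complex.Re (H x))); last first.
  by apply/funext => x; case: (G x) (H x) => [a b] [c d].
by apply: measurable_funD; exact: measurable_funM.
Qed.

Lemma measurable_factor b (sigma : R) :
  complex_measurable (symbol_factor b sigma).
Proof.
have mabs : measurable_fun setT (fun xi : R => `|2 * pi * xi| `^ sigma).
  apply: (measurableT_comp (f := fun y : R => y `^ sigma));
    first exact: measurable_powR.
  by apply: measurableT_comp => //; exact: measurable_funM.
have msg : measurable_fun setT (fun xi : R => Num.sg xi).
  apply: measurable_fun_ifT => //; first exact: measurable_fun_eqr.
  by apply: measurable_fun_ifT => //; exact: measurable_fun_ltr.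
have mth : measurable_fun setT
    (fun xi : R => (-1) ^+ b * (sigma * pi * Num.sg xi / 2)).
  by apply: measurable_funM => //; apply: measurable_funM => //;
    exact: measurable_funM.
split.
  rewrite (_ : (fun x => _) = (fun xi => 1 + chi sigma *
    (`|2 * pi * xi| `^ sigma * cos ((-1) ^+ b * (sigma * pi * Num.sg xi / 2)))));
    last by apply/funext => x /=; ring.
  apply: measurable_funD => //; apply: measurable_funM => //.
  apply: measurable_funM => //; apply: measurableT_comp mth.
  by apply: continuous_measurable_fun; exact: continuous_cos.
rewrite (_ : (fun x => _) = (fun xi => chi sigma *
  (`|2 * pi * xi| `^ sigma * sin ((-1) ^+ b * (sigma * pi * Num.sg xi / 2)))));
  last by apply/funext => x /=; ring.
apply: measurable_funM => //.
apply: measurable_funM => //; apply: measurableT_comp mth.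
by apply: continuous_measurable_fun; exact: continuous_sin.
Qed.

Lemma complex_measurable_prod (I : Type) (r : seq I) (F : I -> R -> R[i]) :
  (forall i, complex_measurable (F i)) ->
  complex_measurable (fun x => \prod_(i <- r) F i x).
Proof.
move=> mF; elim: r => [|i r IH].
  by under eq_fun do rewrite big_nil; split.
by under eq_fun do rewrite big_cons; exact: complex_measurableM.
Qed.

Lemma modulus2M (z w : R[i]) :
  modulus (z * w) ^+ 2 = modulus z ^+ 2 * modulus w ^+ 2.
Proof. by rewrite !modulus2; case: z w => [a b] [c d] /=; ring. Qed.

Lemma modulus2_prod (I : Type) (r : seq I) (z : I -> R[i]) :
  modulus (\prod_(i <- r) z i) ^+ 2 = \prod_(i <- r) modulus (z i) ^+ 2.
Proof.
elim: r => [|i r IH]; last by rewrite !big_cons modulus2M IH.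
by rewrite !big_nil modulus2 /= expr1n expr0n addr0.
Qed.

Lemma measurable_modulus2 (G : R -> R[i]) : complex_measurable G ->
  measurable_fun setT (fun x => modulus (G x) ^+ 2).
Proof.
move=> [mr mi]; under eq_fun do rewrite modulus2.
by apply: measurable_funD; exact: measurable_funX.
Qed.

Lemma measurable_weight (a : R) :
  measurable_fun setT (fun xi : R => 1 + `|2 * pi * xi| `^ a).
Proof.
apply: measurable_funD => //.
apply: (measurableT_comp (f := fun y : R => y `^ a));
  first exact: measurable_powR.
by apply: measurableT_comp => //; exact: measurable_funM.
Qed.

End symbol.

(** * The equivalence *)

Theorem theorem5p1 (R : realType) (s : R) (hs : 0 <= s)
    (n : nat) (hn : (1 <= n)%N)
    (s_ : 'I_n -> R) (hs_ : forall i, 0 <= s_ i)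
    (hsum : \sum_(i < n) s_ i <= s)
    (sgn : 'I_n -> bool) (f : R -> R[i])
    (hf : forall xi : R, xi != 0 ->
       f xi = \prod_(i < n) (1 + (chi (s_ i))%:C * cpow (sgn i) (s_ i) xi))
    (v : R -> R) (hv : L2 v) :
  hatH s v <->
  exists u : R -> R,
    hatH (s - \sum_(i < n) s_ i) u /\
    {ae @lebesgue_measure R, forall xi : R,
       f xi * plancherel v xi = plancherel u xi}.
Proof.
set mu := @lebesgue_measure R; set tau := s - \sum_(i < n) s_ i.
have tau0 : 0 <= tau by rewrite subr_ge0.
have [exT|noT] := pselect (exists T : (R -> R) -> R -> R[i], is_plancherel T);
  last first.
  have P0 : @plancherel R = fun _ _ => 0.
    by apply: xgetPN => T hT; apply: noT; exists T.
  have hatH0 m : hatH m v.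
    split=> //; rewrite P0; under eq_integral do
      rewrite modulus2 /= expr0n addr0 mulr0.
    by rewrite integral0.
  split=> [_|//]; exists v; split=> //.
  by rewrite P0; apply: aeW => xi; rewrite mulr0.
have hP : is_plancherel (@plancherel R) by exact: xgetPex.
have [TL _ _] := hP.
(* F extends the formula for f to xi = 0, where f is arbitrary. *)
pose F xi := \prod_(i < n) symbol_factor (sgn i) (s_ i) xi.
have fF : {ae mu, forall xi, f xi = F xi}.
  exists [set 0]; split; [by []|exact: lebesgue_measure_set1|].
  move=> xi /= nfF; apply/eqP/negPn/negP => xi0; apply: nfF; exact: hf.
have mF : complex_measurable F.
  by apply: complex_measurable_prod => i; exact: measurable_factor.
have FJ xi : F (- xi) = (F xi)^*%C.
  by rewrite /F rmorph_prod; apply: eq_bigr => i _; exact: factor_conj.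
pose w (a xi : R) := 1 + `|2 * pi * xi| `^ (2 * a).
have w1 a xi : 1 <= w a xi by rewrite lerDl powR_ge0.
have w0 a xi : 0 <= w a xi by exact: le_trans (w1 _ _).
pose C : R := 4 ^+ size (index_enum 'I_n).
have C0 : 0 <= C by exact: exprn_ge0.
have Fbounds xi : w s xi <= w tau xi * modulus (F xi) ^+ 2 <= C * w s xi.
  have := @weight_prod R _ (index_enum 'I_n) s_
    (fun i => modulus (symbol_factor (sgn i) (s_ i) xi) ^+ 2) `|2 * pi * xi| tau
    (normr_ge0 _) tau0 hs_ (fun i => factor_modulus2 _ _ (hs_ i)).
  by rewrite subrK -modulus2_prod.
have mW a (G : R -> R[i]) : complex_measurable G ->
    measurable_fun setT (fun xi => (w a xi * modulus (G xi) ^+ 2)%:E).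
  move=> mG; apply/measurable_EFinP/measurable_funM.
    exact: measurable_weight.
  exact: measurable_modulus2.
have W0 a (G : R -> R[i]) xi : (0 <= (w a xi * modulus (G xi) ^+ 2)%:E)%E.
  by rewrite lee_fin mulr_ge0// sqr_ge0.
have [mTv _] := TL _ hv.
pose G xi := F xi * plancherel v xi.
have mG : complex_measurable G by exact: complex_measurableM.
have WG xi : w s xi * modulus (plancherel v xi) ^+ 2 <=
    w tau xi * modulus (G xi) ^+ 2 <=
    C * (w s xi * modulus (plancherel v xi) ^+ 2).
  have /andP[F1 F2] := Fbounds xi.
  rewrite /G modulus2M; have := sqr_ge0 (modulus (plancherel v xi)).
  move: (_ ^+ 2) (_ ^+ 2) F1 F2 => p q F1 F2 q0.
  by rewrite !mulrA !ler_wpM2r.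
split=> [[_ vs]|[u [[Lu us] fu]]]; last first.
  split=> //; have [mTu _] := TL _ Lu; apply: le_lt_trans us.
  rewrite [leRHS](_ : _ = \int[mu]_xi (w tau xi * modulus (G xi) ^+ 2)%:E)%E.
    apply: ge0_le_integral => //;
      [by move=> xi _; exact: (W0 s)|exact: (mW s _ mTv)|exact: (mW tau _ mG)|].
    by move=> xi _; rewrite lee_fin; have /andP[] := WG xi.
  apply: ge0_ae_eq_integral => //;
    [exact: (mW tau _ mTu)|exact: (mW tau _ mG)|
     by move=> xi _; exact: (W0 tau)|].
  by apply: filterS2 fF fu => xi fE uE _; rewrite -uE fE.
have WGfin : (\int[mu]_xi (w tau xi * modulus (G xi) ^+ 2)%:E < +oo)%E.
  apply: (@le_lt_trans _ _
    (\int[mu]_xi (C * (w s xi * modulus (plancherel v xi) ^+ 2))%:E)%E).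
    apply: ge0_le_integral => //; first exact: (mW tau _ mG).
    - apply/measurable_EFinP/measurable_funM => //.
      by apply/measurable_EFinP; exact: (mW s _ mTv).
    - by move=> xi _; rewrite lee_fin; have /andP[] := WG xi.
  under eq_integral do rewrite EFinM.
  rewrite ge0_integralZl//; [|exact: (mW s _ mTv)].
  by rewrite lte_mul_pinfty ?lee_fin.
have LG : complex_L2 G.
  split=> //; apply: le_lt_trans WGfin; apply: ge0_le_integral => //.
  - by move=> xi _; rewrite lee_fin sqr_ge0.
  - by apply/measurable_EFinP; exact: measurable_modulus2.
  - exact: (mW tau _ mG).
  - by move=> xi _; rewrite lee_fin ler_peMl ?sqr_ge0.
have GJ : {ae mu, forall xi, G (- xi) = (G xi)^*%C}.
  have [vr vi] := plancherel_hermitian hP hv.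
  apply: filterS2 vr vi => xi vr vi; rewrite /G rmorphM FJ; congr (_ * _).
  move: vr vi.
  by case: (plancherel v _) (plancherel v _) => [a b] [c d] /= -> ->.
have [u Lu Gu] := plancherel_surjective hP LG GJ.
have [mTu _] := TL _ Lu.
exists u; split; last by apply: filterS2 fF Gu => xi -> <-.
split=> //; apply: le_lt_trans WGfin.
rewrite le_eqVlt; apply/orP; left; apply/eqP.
apply: ge0_ae_eq_integral => //;
  [exact: (mW tau _ mTu)|exact: (mW tau _ mG)|by move=> xi _; exact: (W0 tau)|].
by apply: filterS Gu => xi -> _.
Qed.
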